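(* For each of the following sets $R\subseteq\{0,1,2,3\}^2$ we have $(123,R)\sim_d(132,R)$: (1) $R=\{(0,0),(0,2),(1,1),(1,2),(1,3),(2,0),(2,1),(2,2),(2,3),(3,1),(3,2)\}$; (2) $R=\{(0,0),(0,2),(0,3),(1,1),(1,2),(1,3),(2,0),(2,1),(2,2),(2,3),(3,0),(3,1),(3,2)\}$.
   Context: $S_n$ denotes the set of permutations of $[n]=\{1,\dots,n\}$, written $\pi=\pi_1\cdots\pi_n$. A mesh pattern of length $k$ is a pair $(\tau,R)$ with $\tau\in S_k$ and $R\subseteq\{0,1,\dots,k\}^2$ (the shaded boxes; box $(a,b)$ is the unit square $[a,a+1]\times[b,b+1]$ in the diagram of $\tau$). An occurrence of $(\tau,R)$ in $\pi\in S_n$ is a choice of indices $i_1<\dots<i_k$ such that $\pi_{i_1}\cdots\pi_{i_k}$ is order-isomorphic to $\tau$ and, with $i_0=0$, $i_{k+1}=n+1$, $v_1<\dots<v_k$ the values $\pi_{i_1},\dots,\pi_{i_k}$ sorted increasingly, $v_0=0$, $v_{k+1}=n+1$, for every $(a,b)\in R$ there is no index $m$ with $i_a<m<i_{a+1}$ and $v_b<\pi_m<v_{b+1}$. Mesh patterns $p,q$ are equidistributed, $p\sim_d q$, if for all $n,\ell\ge0$ the number of $\pi\in S_n$ with exactly $\ell$ occurrences of $p$ equals the number with exactly $\ell$ occurrences of $q$. *)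

(* Defs.v *)
From mathcomp Require Import all_boot all_fingroup.

Set Implicit Arguments.
Unset Strict Implicit.
Unset Printing Implicit Defensive.

(* Elements of 'I_n count from 0, so the 1-based position and value of the
   entry m of pi : 'S_n are m.+1 and (pi m).+1.  The boxes of a mesh pattern
   already count from 0. *)
Record mesh_pattern (k : nat) := MeshPattern {
  mesh_perm : 'S_k;
  mesh_boxes : {set 'I_k.+1 * 'I_k.+1}
}.

Definition boxes (k : nat) (s : seq (nat * nat)) : {set 'I_k.+1 * 'I_k.+1} :=
  [set ab : 'I_k.+1 * 'I_k.+1 | (val ab.1, val ab.2) \in s].

Definition perm123 : 'S_3 := 1%g.
Definition perm132 : 'S_3 := tperm (inord 1) (inord 2).

Section Occurrence.

Variables (k n : nat) (pi : 'S_n) (i : {ffun 'I_k -> 'I_n}).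

Definition increasing_indices : bool :=
  [forall a : 'I_k, forall b : 'I_k, (a < b) ==> (i a < i b)].

Definition order_isomorphic (tau : 'S_k) : bool :=
  [forall a : 'I_k, forall b : 'I_k,
     (pi (i a) < pi (i b)) == (tau a < tau b)].

(* The sequences i_0, ..., i_(k+1) and v_0, ..., v_(k+1), with the end points
   0 and n+1 included. *)
Definition position_grid : seq nat :=
  0 :: rcons [seq (i a).+1 | a <- enum 'I_k] n.+1.

Definition value_grid : seq nat :=
  0 :: rcons (sort leq [seq (pi (i a)).+1 | a <- enum 'I_k]) n.+1.

Definition box_empty (a b : nat) : bool :=
  [forall m : 'I_n,
     ~~ [&& nth 0 position_grid a < m.+1 < nth 0 position_grid a.+1
          & nth 0 value_grid b < (pi m).+1 < nth 0 value_grid b.+1]].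

Definition is_occurrence (p : mesh_pattern k) : bool :=
  [&& increasing_indices, order_isomorphic (mesh_perm p)
    & [forall ab in mesh_boxes p, box_empty ab.1 ab.2]].

End Occurrence.

Definition occurrences (k n : nat) (p : mesh_pattern k) (pi : 'S_n) : nat :=
  #|[set i : {ffun 'I_k -> 'I_n} | is_occurrence pi i p]|.

Definition equidistributed (k k' : nat)
    (p : mesh_pattern k) (q : mesh_pattern k') : Prop :=
  forall n l : nat,
    #|[set pi : 'S_n | occurrences p pi == l]| =
    #|[set pi : 'S_n | occurrences q pi == l]|.

(* Main.v *)
(* Let (x, y, z) be the positions of an occurrence of either pattern.  Shading
   column 2 and row 2 forces y and z to be adjacent, with consecutive values:
   call {y, z} a bond.  The remaining boxes force distinct bonds, of either
   pattern, to be disjoint, and x is a left-to-right minimum, hence never lies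
   in a bond.  Swapping the two values at every bond simultaneously therefore
   keeps all the position triples of occurrences, and turns each occurrence of
   123 into one of 132 and conversely: it is an involution of S_n exchanging
   the two statistics.  Only the boxes of the first set are used, so any larger
   set of boxes would do. *)

Require Import Defs.
From mathcomp Require Import all_boot all_fingroup.
From mathcomp Require Import zify.

Set Implicit Arguments.
Unset Strict Implicit.
Unset Printing Implicit Defensive.

(** * Occurrences of the two patterns as inequalities *)

Notation o0 := (@Ordinal 3 0 isT).
Notation o1 := (@Ordinal 3 1 isT).
Notation o2 := (@Ordinal 3 2 isT).

Lemma forall_ord3 (P : pred 'I_3) : [forall a, P a] = [&& P o0, P o1 & P o2].
Proof.
apply/forallP/and3P => [h|[h0 h1 h2]]; first by split.
by case=> [[|[|[|a]]] lt_a3] //; [move: h0 | move: h1 | move: h2];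
  congr (is_true (P _)); apply: val_inj.
Qed.

Lemma enum_ord3 : enum 'I_3 = [:: o0; o1; o2].
Proof.
by rewrite !enum_ordSl (enum_ord0) /=; congr [:: _; _; _]; apply: val_inj.
Qed.

Definition core : seq (nat * nat) :=
  [:: (0, 0); (0, 2); (1, 1); (1, 2); (1, 3); (2, 0);
      (2, 1); (2, 2); (2, 3); (3, 1); (3, 2)].

(* Occurrences of (123, R) and of (132, R) together: the values at i o1 and
   i o2 may come in either order. *)
Definition occ (R : {set 'I_4 * 'I_4}) n (pi : 'S_n)
    (i : {ffun 'I_3 -> 'I_n}) : bool :=
  [&& i o0 < i o1 < i o2, pi (i o0) < pi (i o1), pi (i o0) < pi (i o2)
    & [forall ab in R, box_empty pi i ab.1 ab.2]].

Lemma increasing_indices3 n (i : {ffun 'I_3 -> 'I_n}) :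
  increasing_indices i = (i o0 < i o1 < i o2).
Proof. by rewrite /increasing_indices forall_ord3 !forall_ord3 /=; lia. Qed.

Lemma perm132E :
  (perm132 o0 = o0) * (perm132 o1 = o2) * (perm132 o2 = o1).
Proof.
have i1 : inord 1 = o1 by apply: val_inj; rewrite /= inordK.
have i2 : inord 2 = o2 by apply: val_inj; rewrite /= inordK.
by rewrite /perm132 i1 i2 tpermL tpermR tpermD.
Qed.

Lemma is_occurrence123 R n (pi : 'S_n) i :
  is_occurrence pi i (MeshPattern perm123 R) =
  occ R pi i && (pi (i o1) < pi (i o2)).
Proof.
rewrite /is_occurrence /occ increasing_indices3 /= /order_isomorphic.
rewrite forall_ord3 !forall_ord3 !perm1 /=.
case: [forall ab in R, _]; lia.
Qed.

Lemma is_occurrence132 R n (pi : 'S_n) i :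
  is_occurrence pi i (MeshPattern perm132 R) =
  occ R pi i && (pi (i o2) < pi (i o1)).
Proof.
rewrite /is_occurrence /occ increasing_indices3 /= /order_isomorphic.
rewrite forall_ord3 !forall_ord3 !perm132E /=.
case: [forall ab in R, _]; lia.
Qed.

Lemma position_grid3 n (i : {ffun 'I_3 -> 'I_n}) :
  position_grid i = [:: 0; (i o0).+1; (i o1).+1; (i o2).+1; n.+1].
Proof. by rewrite /position_grid enum_ord3. Qed.

(** Sorting erases which of [i o1] and [i o2] carries the larger value, so both patterns get the
    same grid. *)
Lemma value_grid3 n (pi : 'S_n) (i : {ffun 'I_3 -> 'I_n}) :
    pi (i o0) < pi (i o1) -> pi (i o0) < pi (i o2) ->
  value_grid pi i =
  [:: 0; (pi (i o0)).+1; (minn (pi (i o1)) (pi (i o2))).+1;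
      (maxn (pi (i o1)) (pi (i o2))).+1; n.+1].
Proof.
rewrite /value_grid enum_ord3 [map _ _]/=.
set x := (pi _).+1; set y := (pi _).+1; set z := (pi _).+1 => lt01 lt02.
suff -> : sort leq [:: x; y; z] = [:: x; minn y z; maxn y z].
  by rewrite minnSS maxnSS.
apply: (sorted_eq leq_trans anti_leq).
- exact: sort_sorted leq_total _.
- by rewrite /= !andbT /=; lia.
rewrite perm_sort perm_cons.
by case: (ltnP y z) => [|_] //; rewrite (perm_catC [:: _] [:: _]).
Qed.

(** * What the shaded boxes force *)

Section Core.

Variables (R : {set 'I_4 * 'I_4}) (n : nat).
Hypothesis coreR : boxes 3 core \subset R.
Implicit Types (pi : 'S_n) (i j : {ffun 'I_3 -> 'I_n}) (m : 'I_n).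

(** For literal [a] and [b] the explicit grids compute, so that an empty box turns into plain
    inequalities for [lia]. *)
Lemma core_empty pi i m (a b : nat) : occ R pi i -> (a, b) \in core ->
    nth 0 [:: 0; (i o0).+1; (i o1).+1; (i o2).+1; n.+1] a < m.+1
      < nth 0 [:: 0; (i o0).+1; (i o1).+1; (i o2).+1; n.+1] a.+1 ->
    nth 0 [:: 0; (pi (i o0)).+1; (minn (pi (i o1)) (pi (i o2))).+1;
              (maxn (pi (i o1)) (pi (i o2))).+1; n.+1] b < (pi m).+1
      < nth 0 [:: 0; (pi (i o0)).+1; (minn (pi (i o1)) (pi (i o2))).+1;
              (maxn (pi (i o1)) (pi (i o2))).+1; n.+1] b.+1 -> False.
Proof.
case/and4P=> _ lt01 lt02 /forall_inP hR ab_core.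
have lt_ab : (a < 4) && (b < 4).
  by apply: (allP (_ : all (fun ab => (ab.1 < 4) && (ab.2 < 4)) core) (a, b)).
have [lt_a lt_b] := andP lt_ab.
have /hR : (Ordinal lt_a, Ordinal lt_b) \in R.
  by apply: (subsetP coreR); rewrite inE.
rewrite /box_empty position_grid3 value_grid3 //= => /forallP/(_ m).
by move=> /negP h hp hv; apply: h; rewrite hp hv.
Qed.

Lemma neq_val pi (m m' : 'I_n) : (m : nat) != m' -> (pi m : nat) != pi m'.
Proof. by apply: contraNneq => /val_inj/perm_inj->. Qed.

Lemma core_lr_min pi i m : occ R pi i -> m < i o0 -> pi (i o0) < pi m.
Proof.
move=> occ_i lt_m; have := core_empty (m := m) occ_i (isT : (0, 0) \in core).
rewrite /=; have := @neq_val pi m (i o0); lia.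
Qed.

(** Column 1 is shaded except for its bottom box. *)
Lemma core_between pi i m :
  occ R pi i -> i o0 < m < i o1 -> pi m < pi (i o0).
Proof.
move=> occ_i lt_m.
have h1 := core_empty (m := m) occ_i (isT : (1, 1) \in core).
have h2 := core_empty (m := m) occ_i (isT : (1, 2) \in core).
have h3 := core_empty (m := m) occ_i (isT : (1, 3) \in core).
rewrite /= in h1 h2 h3.
have [/andP[lt01 lt12] _ _ _] := and4P occ_i.
have := @neq_val pi m (i o0); have := @neq_val pi m (i o1).
have := @neq_val pi m (i o2); have := ltn_ord (pi m); lia.
Qed.

(** Row 1 is shaded except for its leftmost box. *)
Lemma core_row1 pi i m :
  occ R pi i -> pi (i o0) < pi m -> pi m < pi (i o1) -> pi m < pi (i o2) ->
  m < i o0.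
Proof.
move=> occ_i lt0m ltm1 ltm2.
have h1 := core_empty (m := m) occ_i (isT : (1, 1) \in core).
have h2 := core_empty (m := m) occ_i (isT : (2, 1) \in core).
have h3 := core_empty (m := m) occ_i (isT : (3, 1) \in core).
rewrite /= in h1 h2 h3.
have [/andP[lt01 lt12] _ _ _] := and4P occ_i.
have neq (k : 'I_n) : (pi m : nat) != pi k -> (m : nat) != k.
  by apply: contraNneq => /val_inj->.
have := neq (i o0); have := neq (i o1).
have := neq (i o2); have := ltn_ord m; lia.
Qed.

(** Column 2 is shaded entirely; a gap would put the entry just after [i o1] into one of its
    boxes. *)
Lemma core_adjacent pi i : occ R pi i -> i o2 = (i o1).+1 :> nat.
Proof.
move=> occ_i; have [/andP[lt01 lt12] lt_v1 lt_v2 _] := and4P occ_i.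
have := ltn_ord (i o2).
case: (leqP (i o2) (i o1).+1) => [|lt_m ltn]; first by lia.
have lt_n : (i o1).+1 < n by lia.
pose m := Ordinal lt_n.
have h0 := core_empty (m := m) occ_i (isT : (2, 0) \in core).
have h1 := core_empty (m := m) occ_i (isT : (2, 1) \in core).
have h2 := core_empty (m := m) occ_i (isT : (2, 2) \in core).
have h3 := core_empty (m := m) occ_i (isT : (2, 3) \in core).
rewrite /= in h0 h1 h2 h3.
have := @neq_val pi m (i o0); have := @neq_val pi m (i o1).
have := @neq_val pi m (i o2); have := ltn_ord (pi m); rewrite /=; lia.
Qed.

(** Row 2 is shaded entirely; a gap would put the entry whose value is one above the lower of the
    two into one of its boxes. *)
Lemma core_consecutive pi i :
  occ R pi i -> pi (i o1) = (pi (i o2)).+1 :> nat \/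
                pi (i o2) = (pi (i o1)).+1 :> nat.
Proof.
move=> occ_i; have [/andP[lt01 lt12] lt_v1 lt_v2 _] := and4P occ_i.
have neq12 : (pi (i o1) : nat) != pi (i o2) by apply: neq_val; lia.
set lo := minn (pi (i o1)) (pi (i o2)).
case: (ltnP lo.+1 (maxn (pi (i o1)) (pi (i o2)))) => [lt_hi|]; last by lia.
have lt_n : lo.+1 < n.
  by have := ltn_ord (pi (i o1)); have := ltn_ord (pi (i o2)); lia.
pose m := (pi^-1)%g (Ordinal lt_n).
have pim : pi m = lo.+1 :> nat by rewrite permKV.
have h0 := core_empty (m := m) occ_i (isT : (0, 2) \in core).
have h1 := core_empty (m := m) occ_i (isT : (1, 2) \in core).
have h2 := core_empty (m := m) occ_i (isT : (2, 2) \in core).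
have h3 := core_empty (m := m) occ_i (isT : (3, 2) \in core).
rewrite /= in h0 h1 h2 h3.
have neq (k : 'I_n) : (pi m : nat) != pi k -> (m : nat) != k.
  by apply: contraNneq => /val_inj->.
have := neq (i o0); have := neq (i o1).
have := neq (i o2); have := ltn_ord m; lia.
Qed.

(** A shared point would give three adjacent entries with consecutive values, monotone because [pi]
    is injective. Each direction violates a different constraint. *)
Lemma core_disjoint pi i j : occ R pi i -> occ R pi j -> i o2 != j o1.
Proof.
move=> occ_i occ_j; apply/eqP => eq_ij.
have [/andP[i01 i12] vi1 vi2 _] := and4P occ_i.
have [/andP[j01 j12] vj1 vj2 _] := and4P occ_j.
have ai := core_adjacent occ_i; have aj := core_adjacent occ_j.
have neq : (pi (i o1) : nat) != pi (j o2).
  by apply: neq_val; rewrite aj -eq_ij; lia.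
have ci := core_consecutive occ_i; have cj := core_consecutive occ_j.
rewrite eq_ij in ci ai i12 vi2.
case: cj => cj; last first.
(* Increasing: either [i o1] lies in column 1 of [j] but too high, or it equals [j o0] and has the
   lower entry [i o0] to its left. *)
- have {}ci : pi (j o1) = (pi (i o1)).+1 :> nat by lia.
  case: (ltnP (j o0) (i o1)) => lt_j.
    by have := core_between occ_j (m := i o1); lia.
  have eq_j : j o0 = i o1 by apply: val_inj => /=; lia.
  by have := core_lr_min occ_j (m := i o0); rewrite eq_j; lia.
(* Decreasing: [j o2] lies in row 1 of [i], to the right of [i o0]. *)
have := core_row1 occ_i (m := j o2); rewrite eq_ij.
have : (pi (i o0) : nat) != pi (j o2) by apply: neq_val; lia.
lia.
Qed.

(** * Bonds and swaps along them *)

Definition bond pi : rel 'I_n := fun m m' =>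
  [exists i, occ R pi i && (((m == i o1) && (m' == i o2))
                         || ((m == i o2) && (m' == i o1)))].

Lemma bondP pi m m' :
  reflect (exists2 i, occ R pi i & (m = i o1 /\ m' = i o2) \/
                                  (m = i o2 /\ m' = i o1))
          (bond pi m m').
Proof.
apply: (iffP existsP) => [[i /andP[occ_i h]]|[i occ_i h]]; exists i => //.
  by case/orP: h => /andP[/eqP-> /eqP->]; [left|right].
by rewrite occ_i; case: h => -[-> ->]; rewrite !eqxx ?orbT.
Qed.

Lemma bond_sym pi : symmetric (bond pi).
Proof.
move=> m m'; apply/bondP/bondP => -[i occ_i h]; exists i => //; tauto.
Qed.

(** Two bonds at [m] coincide by adjacency if [m] is on the same side of both, and contradict
    [core_disjoint] otherwise. *)
Lemma bond_inj pi m a b : bond pi m a -> bond pi m b -> a = b.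
Proof.
case/bondP=> i occ_i mi /bondP[j occ_j mj]; apply: val_inj => /=.
have := core_adjacent occ_i; have := core_adjacent occ_j.
have := core_disjoint occ_i occ_j; have := core_disjoint occ_j occ_i.
rewrite -!val_eqE /=.
by case: mi mj => -[-> ->] [] [/(congr1 val)/= eq_ij ->]; lia.
Qed.

Lemma bond_near pi m m' : bond pi m m' -> m <= m'.+1 /\ m' <= m.+1.
Proof.
by case/bondP=> i /core_adjacent adj [] [-> ->]; lia.
Qed.

Lemma bond_occ pi i : occ R pi i -> bond pi (i o1) (i o2).
Proof. by move=> occ_i; apply/bondP; exists i => //; left. Qed.

(** Each entry of a bond has the lower entry [j o0] to its left, whereas [i o0] is a left-to-right
    minimum. *)
Lemma bond_min pi i m : occ R pi i -> ~~ bond pi (i o0) m.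
Proof.
move=> occ_i; apply/negP => /bondP[j occ_j].
have [/andP[j01 j12] vj1 vj2 _] := and4P occ_j.
by case=> -[eq_ij _]; have := core_lr_min occ_i (m := j o0);
  rewrite eq_ij; lia.
Qed.

(* The boxes of the triple i stay empty because both points of a bond disjoint
   from i lie in the same box of i. *)
Lemma occ_swap pi (t : 'S_n) i :
    involutive t -> (forall m, t m != m -> bond pi m (t m)) ->
  occ R pi i -> occ R (t * pi)%g i.
Proof.
move=> tK bond_t occ_i.
have [/andP[i01 i12] vi1 vi2 /forall_inP hR] := and4P occ_i.
have t0 : t (i o0) = i o0.
  by apply/eqP; apply: contraT => /bond_t; rewrite (negPf (bond_min _ occ_i)).
have b12 := bond_occ occ_i.
have t12 : (t (i o1) = i o1 /\ t (i o2) = i o2) \/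
           (t (i o1) = i o2 /\ t (i o2) = i o1).
  have [t1|/bond_t/bond_inj/(_ b12) t1] := eqVneq (t (i o1)) (i o1); last first.
    by right; rewrite -t1 tK.
  have [t2|/bond_t/bond_inj t2] := eqVneq (t (i o2)) (i o2); first by left.
  by right; move: (t2 (i o1)); rewrite bond_sym => /(_ b12) t2'; rewrite -t2' tK.
have tI := inv_inj tK.
have tE m : [|| m == i o0, m == i o1 | m == i o2] =
            [|| t m == i o0, t m == i o1 | t m == i o2].
  rewrite -(inj_eq tI m (i o0)) -(inj_eq tI m (i o1)) -(inj_eq tI m (i o2)) t0.
  by case: t12 => -[-> ->] //; congr (_ || _); apply: orbC.
have vg : value_grid (t * pi)%g i = value_grid pi i.
  rewrite /value_grid enum_ord3 /=; congr (_ :: rcons _ _).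
  apply/perm_sortP => //; [exact: leq_total | exact: leq_trans | exact: anti_leq |].
  rewrite !permM t0 perm_cons.
  by case: t12 => -[-> ->] //; rewrite (perm_catC [:: _] [:: _]).
apply/and4P; split; rewrite ?permM ?t0; [by rewrite i01 | by case: t12 => -[-> _] |
  by case: t12 => -[_ ->] |].
apply/forall_inP => -[a b] /hR /= /forallP hab; apply/forallP => m.
rewrite vg permM; apply: contra (hab (t m)) => /andP[+ ->]; rewrite andbT.
(* An entry outside the triple moves by at most one position and, by [tE], stays outside, so it
   keeps its column. *)
have near : m <= (t m).+1 /\ t m <= m.+1.
  have [->|/bond_t/bond_near //] := eqVneq (t m) m; lia.
rewrite position_grid3; case: a {hab} => -[|[|[|[|//]]]] lt_a /=;
  move: near (tE m) (ltn_ord m) (ltn_ord (t m)); rewrite -!val_eqE /=;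
  move: (nat_of_ord (t m)) (nat_of_ord m) i01 i12 => tm k;
  case: eqVneq => [->|]; last (case: eqVneq => [->|]; last case: eqVneq => [->|]);
  clear; lia.
Qed.

(** * The involution and the count *)

Definition partner pi (m : 'I_n) : 'I_n := odflt m [pick m' | bond pi m m'].

Lemma partner_bond pi m m' : bond pi m m' -> partner pi m = m'.
Proof.
rewrite /partner => b; case: pickP => [k /bond_inj/(_ b) //|/(_ m')].
by rewrite b.
Qed.

Lemma bond_partner pi m : partner pi m != m -> bond pi m (partner pi m).
Proof. by rewrite /partner; case: pickP => //=; rewrite eqxx. Qed.

Lemma partnerK pi : involutive (partner pi).
Proof.
move=> m; have [e|/bond_partner b] := eqVneq (partner pi m) m.
  by rewrite !e.
by apply: partner_bond; rewrite bond_sym.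
Qed.

Definition flip pi : 'S_n := (perm (inv_inj (partnerK pi)) * pi)%g.

(** One direction is [occ_swap]. It also makes every bond of [pi] a bond of [t * pi], so it applies
    again with the same [t], and [t * (t * pi)] is [pi]. Hence its form for an arbitrary involution
    along bonds. *)
Lemma occ_flip pi i : occ R (flip pi) i = occ R pi i.
Proof.
rewrite /flip; set t := perm _.
have tK : involutive t by move=> m; rewrite !permE partnerK.
have bt m : t m != m -> bond pi m (t m) by rewrite permE; apply: bond_partner.
move: t tK bt => t tK bt.
have occ_t k : occ R pi k -> occ R (t * pi)%g k := @occ_swap pi t k tK bt.
apply/idP/idP => [occ_i|/occ_t //].
have bt' m : t m != m -> bond (t * pi)%g m (t m).
  by move=> /bt /bondP[k occ_k mk]; apply/bondP; exists k => //; apply: occ_t.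
have := occ_swap tK bt' occ_i.
have -> // : (t * (t * pi))%g = pi.
by apply/permP => m; rewrite !permM tK.
Qed.

Lemma bond_flip pi : bond (flip pi) =2 bond pi.
Proof. by move=> m m'; apply: eq_existsb => i; rewrite occ_flip. Qed.

Lemma flipK : involutive flip.
Proof.
move=> pi; apply/permP => m; rewrite !permM !permE.
have -> : partner (flip pi) m = partner pi m.
  by rewrite /partner (eq_pick (bond_flip pi m)).
by rewrite partnerK.
Qed.

Lemma flip_occ pi i : occ R pi i ->
  flip pi (i o1) = pi (i o2) /\ flip pi (i o2) = pi (i o1).
Proof.
move=> /bond_occ b; rewrite !permM !permE (partner_bond b).
by rewrite bond_sym in b; rewrite (partner_bond b).
Qed.

Lemma occurrences_flip pi :
  occurrences (MeshPattern perm123 R) (flip pi) =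
  occurrences (MeshPattern perm132 R) pi.
Proof.
apply: eq_card => i; rewrite !inE is_occurrence123 is_occurrence132 occ_flip.
by case occ_i: (occ R pi i) => //=; have [-> ->] := flip_occ occ_i.
Qed.

End Core.

Theorem core_equidistributed (R : {set 'I_4 * 'I_4}) :
    boxes 3 core \subset R ->
  equidistributed (MeshPattern perm123 R) (MeshPattern perm132 R).
Proof.
move=> coreR n l.
(* The left set is replaced by its image under [flip], which is the right set. *)
rewrite -(card_imset _ (inv_inj (@flipK R n coreR))); apply: eq_card => pi.
rewrite -{1}[pi](flipK coreR) (mem_imset _ _ (inv_inj (flipK coreR))) !inE.
by rewrite occurrences_flip.
Qed.

Theorem theorem3p8 :
  (let R := boxes 3 [:: (0, 0); (0, 2); (1, 1); (1, 2); (1, 3); (2, 0);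
                        (2, 1); (2, 2); (2, 3); (3, 1); (3, 2)] in
   equidistributed (MeshPattern perm123 R) (MeshPattern perm132 R)) /\
  (let R := boxes 3 [:: (0, 0); (0, 2); (0, 3); (1, 1); (1, 2); (1, 3); (2, 0);
                        (2, 1); (2, 2); (2, 3); (3, 0); (3, 1); (3, 2)] in
   equidistributed (MeshPattern perm123 R) (MeshPattern perm132 R)).
Proof.
split=> R; apply: core_equidistributed; first exact: subxx.
apply/subsetP => ab; rewrite [_ \in boxes _ _]in_set [_ \in R]in_set.
(* What remains is the inclusion of two explicit lists, settled by evaluation. *)
by move: (_, _); apply/allP.
Qed.
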